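(* Let $k > 2$ and $p > 1$ be integers. If $G$ is a $(k^p+1,1)$-ear graph, then $G$ has (strong) periodicity number $p$ under the $k$-distance operator, i.e. $\rho^k(G) = p$.
   Context: Graphs are simple and undirected; $d_G(u,v)$ denotes geodesic distance (length of a shortest path) in $G$, and $N_G(x)$ the neighborhood of $x$. For $k>1$, the $k$-distance operator $D^k$ sends a graph $G$ to the graph $D^k(G)$ on the same vertex set in which $u,v$ are adjacent if and only if $d_G(u,v)=k$. Set $G_1^k = G$ and $G_t^k = D^k(G_{t-1}^k)$ for $t>1$. The periodicity number $\rho^k(G)$ is $f-1$, where $f>1$ is the least integer such that $G_f^k \cong G_1^k$ (graph isomorphism); if no such $f$ exists, $\rho^k(G)=0$. Two vertices $u,v$ are false twins if $N_G(u)=N_G(v)$ and $u \notin N_G(v)$. An ear graph is a graph $G=(V,E)$ that contains an induced cycle on $|V|-2$ vertices such that two (distinct) vertices $a,b$ of the cycle have false twins $a',b'$ respectively, where $a',b'$ are the two vertices of $G$ not on the cycle. With $n=|V|-2$ and $d=d_G(a,b)$, such a $G$ is called an $(n,d)$-ear graph (or $(n,d)$-ear). *)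

(* Defs.v *)
From mathcomp Require Import all_boot.
From mathcomp Require Import boolp.

Set Implicit Arguments.
Unset Strict Implicit.
Unset Printing Implicit Defensive.

Record sgraph := SGraph {
  vertex :> finType;
  adj : rel vertex;
  adj_sym : symmetric adj;
  adj_irrefl : irreflexive adj
}.

Arguments adj {s}.

Section Distance.
Variable G : sgraph.
Implicit Types u v : G.

Definition nbhd u : {set G} := [set v | adj u v].

(* There is a path (no repeated vertex) with m edges from u to v; the tuple
   lists its vertices after u. *)
Definition has_path u v (m : nat) : bool :=
  [exists q : m.-tuple G, [&& path adj u q, uniq (u :: q) & last u q == v]].

(* The length of a shortest path, or None when u and v lie in different
   components.  A path of G has fewer than #|G| edges, so iota 0 #|G| covers
   every possible length. *)
Definition gdist u v : option nat :=
  ohead [seq m <- iota 0 #|G| | has_path u v m].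

Lemma has_path_lt u v m : has_path u v m -> m < #|G|.
Proof.
case/existsP=> q /and3P[_ uq _].
by have := max_card (mem (u :: q)); rewrite (card_uniqP uq) /= size_tuple.
Qed.

Lemma gdistP u v m :
  gdist u v = Some m <->
  has_path u v m /\ (forall l, has_path u v l -> m <= l).
Proof.
rewrite /gdist.
have srt : sorted leq [seq l <- iota 0 #|G| | has_path u v l].
  by apply: sorted_filter; [exact: leq_trans | exact: iota_sorted].
have mem_s l : (l \in [seq l <- iota 0 #|G| | has_path u v l]) = has_path u v l.
  rewrite mem_filter mem_iota /= add0n.
  by case: (boolP (has_path u v l)) => //= /has_path_lt.
case: [seq _ <- _ | _] srt mem_s => [|x s] /= srt mem_s; split.
- by [].
- by case=> um _; move: (mem_s m); rewrite um.
- case=> <-; split; first by rewrite -mem_s mem_head.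
  move=> l; rewrite -mem_s inE => /predU1P[->//|ls].
  by move: srt; rewrite (path_sortedE leq_trans) => /andP[/allP/(_ _ ls)].
- case=> um min_m; congr Some; apply/eqP; rewrite eqn_leq min_m ?andbT.
    move: um; rewrite -mem_s inE => /predU1P[->//|ls].
    by move: srt; rewrite (path_sortedE leq_trans) => /andP[/allP/(_ _ ls)].
  by rewrite -mem_s mem_head.
Qed.

Lemma has_path_sym u v m : has_path u v m = has_path v u m.
Proof.
suff imp x y : has_path x y m -> has_path y x m by apply/idP/idP; apply: imp.
case/existsP=> q /and3P[pq uq /eqP lq].
have sz : size (rev (belast x q)) == m by rewrite size_rev size_belast size_tuple.
apply/existsP; exists (Tuple sz) => /=; apply/and3P; split.
- rewrite -lq rev_path; rewrite (eq_path (e' := adj)) // => a b.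
  exact: adj_sym.
- by rewrite -[_ && _]/(uniq (y :: rev (belast x q))) -lq -rev_rcons -lastI rev_uniq.
- case: (tval q) lq => [|z s] /= => [->//|_].
  by rewrite rev_cons last_rcons.
Qed.

Lemma gdist_sym u v : gdist u v = gdist v u.
Proof. by rewrite /gdist (eq_filter (has_path_sym u v)). Qed.

Definition false_twins u v : Prop :=
  [/\ u != v, nbhd u = nbhd v & u \notin nbhd v].

(* c lists the vertices of the cycle in cyclic order; the last clause says that
   the edges of G between vertices of c are exactly the edges of the cycle. *)
Definition induced_cycle (c : seq G) : Prop :=
  [/\ 2 < size c, uniq c &
      {in c &, forall x y, adj x y = (y == next c x) || (x == next c y)}].

Definition ear_graph (n d : nat) : Prop :=
  n = #|G| - 2 /\
  exists c : seq G,
    [/\ induced_cycle c, size c = #|G| - 2 &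
        exists a b a' b' : G,
          [/\ [/\ a \in c, b \in c & a != b],
              a' != b' /\ [set x | x \notin c] = [set a'; b'],
              false_twins a a',
              false_twins b b' &
              gdist a b = Some d]].

Variable k : nat.

(* For k > 0 the conjunct u != v is implied by the other one; it only makes the
   relation irreflexive for every k. *)
Definition kdist_adj : rel G := [rel u v | (u != v) && (gdist u v == Some k)].

Lemma kdist_adj_sym : symmetric kdist_adj.
Proof. by move=> u v; rewrite /kdist_adj /= eq_sym gdist_sym. Qed.

Lemma kdist_adj_irrefl : irreflexive kdist_adj.
Proof. by move=> u; rewrite /kdist_adj /= eqxx. Qed.

Definition kdist_graph : sgraph := SGraph kdist_adj_sym kdist_adj_irrefl.

End Distance.

Definition isomorphic (G H : sgraph) : Prop :=
  exists2 f : G -> H, bijective f & {mono f : x y / adj x y}.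

(* The sequence is indexed from 1: kseq k G 1 is G and, for t > 1,
   kseq k G t is kdist_graph (kseq k G t.-1) k. *)
Definition kseq (k : nat) (G : sgraph) (t : nat) : sgraph :=
  iter t.-1 (fun H => kdist_graph H k) G.

Definition returns (k : nat) (G : sgraph) (f : nat) : bool :=
  (1 < f) && `[< isomorphic (kseq k G f) (kseq k G 1) >].

Definition periodicity_number (k : nat) (G : sgraph) : nat :=
  match pselect (exists f, returns k G f) with
  | left ex_f => ex_minn ex_f - 1
  | right _ => 0
  end.

(* Main.v *)
Require Import Defs.
From mathcomp Require Import all_boot all_algebra.
From mathcomp Require Import boolp.
From mathcomp Require Import ring zify.

(** An [(n, 1)]-ear is the cycle Z/n with two consecutive positions doubled, so
its vertices carry a coordinate in Z/n and adjacency means that the coordinates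
differ by [+-1].  If adjacency means that they differ by [+-s], with [s] a unit,
then distance [k] (for [2 < k < n / 2]) means that they differ by [+-k s]; twins
do not interfere, being at distance 2.  Hence after [m] applications of the
operator the step is [k ^ m].  For [n = k ^ p + 1] the step returns to [-1] at
[m = p], which is the original graph.  For [0 < m < p] the step is not [+-1], and
since the twins of the new graph still sit only at the two doubled positions,
which differ by [1], no twin of one pair is adjacent to one of the other,
contrary to what happens in the ear. *)

Set Implicit Arguments.
Unset Strict Implicit.
Unset Printing Implicit Defensive.

Import GRing.Theory.

(** * Graphs with a coordinate in Z/n, and their distances *)

Section CyclicCoordinate.
Local Open Scope ring_scope.

Variable n : nat.
Hypothesis n_gt1 : (1 < n)%N.

Lemma eqr_nat_Zp (i j : nat) : (i%:R == j%:R :> 'Z_n) = (i == j %[mod n])%N.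
Proof. by rewrite -val_eqE /= !val_Zp_nat. Qed.

Lemma mulIr_nat_Zp (s : 'Z_n) (i j : nat) : s \is a GRing.unit ->
  i%:R * s = j%:R * s -> (i = j %[mod n])%N.
Proof. by move=> Us /(mulIr Us)/eqP; rewrite eqr_nat_Zp => /eqP. Qed.

(** [f] need not be injective: vertices with equal coordinates have the same neighbours, which is
    how twins are encoded. *)
Definition coordinate (H : sgraph) (f : H -> 'Z_n) (s : 'Z_n) : Prop :=
  forall u v : H, adj u v = (f v == f u + s) || (f u == f v + s).

Section Walks.
Variables (H : sgraph) (f : H -> 'Z_n) (s : 'Z_n).
Hypotheses (fs : coordinate f s) (f_surj : forall z, exists u, f u = z).
Hypothesis Us : s \is a GRing.unit.

(** [i] and [j] count the steps by [+s] and by [-s]. *)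
Lemma walk_coordinate (u : H) (q : seq H) : path adj u q ->
  exists i j : nat,
    (i + j = size q)%N /\ f (last u q) + j%:R * s = f u + i%:R * s.
Proof.
elim: q u => [|w q IH] u /=; first by exists 0, 0.
case/andP; rewrite fs => uw /IH[i [j [<- e]]].
case/orP: uw => /eqP uw.
  by exists i.+1, j; split; [rewrite addSn | rewrite e uw -natr1; ring].
exists i, j.+1; split; first by rewrite addnS.
by rewrite uw -natr1 -[RHS]addrAC -e; ring.
Qed.

(** Surjectivity of [f] lifts each intermediate coordinate to a vertex. At least one step is taken,
    so that the walk can end at [v] itself and not at a twin of it. The list of coordinates later
    shows that the walk has no repetition. *)
Lemma straight_walk (u v : H) (m : nat) : f v = f u + m.+1%:R * s ->
  exists q : seq H, [/\ path adj u q, last u q = v &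
    map f (u :: q) = [seq f u + i%:R * s | i <- iota 0 m.+2]].
Proof.
elim: m u => [|m IH] u fv.
  exists [:: v]; split=> //=; last by rewrite fv mul0r addr0.
  by rewrite fs fv mul1r eqxx.
have [w fw] := f_surj (f u + s).
have [|q [pq lq mq]] := IH w; first by rewrite fv fw -[in LHS]natr1; ring.
exists (w :: q); split=> //; first by rewrite /= fs fw eqxx.
rewrite -[iota 0 _]/(0 :: iota (1 + 0) m.+2)%N iotaDl map_cons mq map_cons.
rewrite mul0r addr0 -map_comp; congr (_ :: _).
by apply: eq_map => i /=; rewrite fw natrD; ring.
Qed.

Lemma has_path_straight (u v : H) (m : nat) : (0 < m < n)%N ->
  f v = f u + m%:R * s -> has_path u v m.
Proof.
case: m => // m /= m_lt /straight_walk[q [pq lq mq]].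
have sq : size q == m.+1.
  by have /(congr1 size) := mq; rewrite !size_map /= size_iota => -[->].
apply/existsP; exists (Tuple sq); rewrite /= pq lq eqxx andbT /=.
rewrite -[_ && _]/(uniq (u :: q)); apply: (@map_uniq _ _ f); rewrite mq.
rewrite map_inj_in_uniq ?iota_uniq // => i j.
rewrite !mem_iota => /andP[_ i_lt] /andP[_ j_lt] /addrI/(mulIr_nat_Zp Us).
by rewrite !modn_small //; lia.
Qed.

Lemma has_path_twins (u v : H) : u != v -> f u = f v -> has_path u v 2.
Proof.
move=> uv fuv; have [w fw] := f_surj (f u + s).
have nfw : f u != f w.
  rewrite fw -[X in X == _]addr0 (inj_eq (addrI _)) eq_sym.
  by apply: contraTneq Us => ->; rewrite unitr0.
apply/existsP; exists [tuple w; v] => /=; rewrite !fs -fuv fw !eqxx orbT /=.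
rewrite !inE negb_or uv andbT /=.
by rewrite !andbT; apply/andP; split; apply: contra_neq nfw => ->.
Qed.

Lemma gdist_coordinate (k : nat) (u v : H) : (2 < k)%N -> (2 * k <= n)%N ->
  (gdist u v == Some k) = (f v == f u + k%:R * s) || (f u == f v + k%:R * s).
Proof.
move=> k_gt2 kn.
have ahead (x y : H) : f y = f x + k%:R * s -> gdist x y = Some k.
  move=> fy; apply/gdistP; split; first by apply: has_path_straight fy; lia.
  move=> l /existsP[q /and3P[/walk_coordinate[i [j [ij e]]] _ /eqP lq]].
  move: e; rewrite lq fy -addrA -mulrDl -natrD size_tuple in ij *.
  move/addrI/(mulIr_nat_Zp Us) => e; rewrite leqNgt; apply/negP=> lk.
  (* [n] would divide [k + j - i], which is positive and below [2 * k] because [i + j < k]. *)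
  have/eqP := e; rewrite eqn_mod_dvd; last by lia.
  by move/dvdn_leq => /(_ _); lia.
apply/eqP/idP; last first.
  by case/orP=> /eqP/ahead //; rewrite gdist_sym.
(* Cancelling opposite steps leaves a straight path of length [i - j], so minimality forces [j = 0].
   If [i = j], the endpoints are equal or twins, at distance at most 2. *)
have close (x y : H) (i j : nat) : gdist x y = Some k -> (i + j = k)%N ->
    (j <= i)%N -> f y + j%:R * s = f x + i%:R * s -> f y == f x + k%:R * s.
  case/gdistP=> _ min_k ij ji e.
  have fy : f y = f x + (i - j)%:R * s.
    by apply: (addIr (j%:R * s)); rewrite e -addrA -mulrDl -natrD subnK.
  have [ij0|ij_gt0] := posnP (i - j)%N; last first.
    have /min_k le_k : has_path x y (i - j).
      by apply: has_path_straight fy; lia.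
    by rewrite fy; apply/eqP; congr (_ + _%:R * _); lia.
  move: fy; rewrite ij0 mul0r addr0 => fy.
  have [xy|xy] := eqVneq x y.
    have /min_k : has_path x y 0.
      by apply/existsP; exists [tuple]; rewrite /= xy eqxx.
    by lia.
  by have /min_k := has_path_twins xy (esym fy); lia.
move=> d_uv; have /gdistP[/existsP[q qP] _] := d_uv.
case/and3P: qP => /walk_coordinate[i [j [ij e]]] _ /eqP lq.
move: e; rewrite lq size_tuple in ij * => e; have [ji|/ltnW ij'] := leqP j i.
  by rewrite (close u v i j).
apply/orP; right; apply: (close v u j i) => //; first by rewrite gdist_sym.
by rewrite addnC.
Qed.

Lemma kdist_coordinate (k : nat) : (2 < k)%N -> (2 * k <= n)%N ->
  coordinate (H := kdist_graph H k) f (k%:R * s).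
Proof.
move=> k_gt2 kn u v.
rewrite -(gdist_coordinate u v k_gt2 kn) /adj /= /kdist_adj /=.
have [->|//] := eqVneq u v; symmetry; apply/eqP=> /gdistP[_ min_k].
have /min_k : has_path (v : H) v 0.
  by apply/existsP; exists [tuple]; rewrite /= eqxx.
by lia.
Qed.

(** If the coordinates differed, the neighbours of [x] on either side would lie on the opposite
    sides of [y], whence [4 s = 0]; in a 4-cycle this does happen. *)
Lemma coordinate_twins (x y : H) : (4 < n)%N ->
  (forall w, adj x w = adj y w) -> f x = f y.
Proof.
move=> n_gt4 xy; apply/eqP; apply/negPn/negP => nxy.
have [w fw] := f_surj (f x + s); have [z fz] := f_surj (f x - s).
have := xy z; have := xy w.
rewrite !fs fw fz subrK !eqxx orbT (inj_eq (addIr _)) (negbTE nxy) /=.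
move=> /esym/eqP e /esym/orP[/eqP e'|/eqP e']; last first.
  by rewrite e' eqxx in nxy.
have : 4%:R * s = 0%:R * s.
  have -> : 4%:R * s = f x + s + s - (f x - s) + s by ring.
  by rewrite -e e'; ring.
by move/(mulIr_nat_Zp Us); rewrite !modn_small; lia.
Qed.

End Walks.

(** The operator keeps the vertex set, but for a variable [m] the vertex type does not reduce to
    that of [G]; the bijection [i] stands for the identity. *)
Lemma kseq_coordinate (k m : nat) (G : sgraph) (f : G -> 'Z_n) :
  (2 < k)%N -> (2 * k <= n)%N -> coprime n k ->
  (forall z, exists u, f u = z) -> coordinate f 1 ->
  exists2 i : kseq k G m.+1 -> G, bijective i & coordinate (f \o i) (k ^ m)%:R.
Proof.
move=> k_gt2 kn cop f_surj f1; rewrite /kseq [m.+1.-1]/=.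
elim: m => [|m [i i_bij fi]]; first by exists id => //; exists id.
exists i => //; rewrite expnS natrM; apply: kdist_coordinate => //.
- move=> z; have [u <-] := f_surj z; case: i_bij => j ij ji.
  by exists (j u); rewrite /= ji.
- by rewrite unitZpE // coprimeXr.
Qed.

End CyclicCoordinate.

(** * From an ear graph to its coordinate *)

Lemma index_next (T : eqType) (c : seq T) (x : T) : uniq c -> x \in c ->
  index (next c x) c = (index x c).+1 %% size c.
Proof.
move=> uc xc; rewrite next_nth xc; case: c uc xc => // y c uc xc.
have : index x (y :: c) < size (y :: c) by rewrite index_mem.
set j := index x _; rewrite [size (y :: c)]/= ltnS leq_eqVlt.
(* For the last vertex, [nth] runs off the list and its default is the head [y], of index 0. *)
case/predU1P=> [->|j_lt]; first by rewrite nth_default // modnn /= eqxx.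
by rewrite modn_small // -[nth y c j]/(nth y (y :: c) j.+1) index_uniq.
Qed.

Lemma ear_coordinate (n : nat) (G : sgraph) : ear_graph G n 1 ->
  [/\ 2 < n &
    exists (f : G -> 'Z_n) (a b a' b' : G),
    [/\ coordinate f 1%R, forall z, exists u, f u = z,
        forall x y, x != y -> f x = f y -> f x \in [:: f a; f b],
        [/\ a != a', forall w, adj a w = adj a' w, b != b' &
            forall w, adj b w = adj b' w] &
        adj a b]].
Proof.
case=> -> [c [[c_gt2 uc cE] <- [a [b [a' [b']]]]]].
case=> -[ac bc ab] [ab' ncE] [aa' Na _] [bb' Nb _] /gdistP[ab1 _].
have twin (x y : G) : nbhd x = nbhd y -> forall w, adj x w = adj y w.
  by move=> xy w; move/setP/(_ w): xy; rewrite !inE.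
have {}Na := twin _ _ Na; have {}Nb := twin _ _ Nb.
split=> //; have n_gt1 := ltnW c_gt2.
(* Folding each twin onto its original retracts [G] onto the cycle and preserves adjacency; the
   coordinate is the index after folding. *)
pose r x := if x == a' then a else if x == b' then b else x.
have rc x : r x \in c.
  rewrite /r; case: eqVneq => // xa'; case: eqVneq => // xb'.
  apply/negPn; move/setP/(_ x): ncE.
  by rewrite !inE (negPf xa') (negPf xb') => ->.
have adj_r x y : adj x y = adj (r x) y.
  by rewrite /r; case: eqVneq => [->|_]; [|case: eqVneq => [->|]].
have c_n z : z \in c -> index z c < size c by rewrite index_mem.
have a'c : a' \notin c by have /setP/(_ a') := ncE; rewrite !inE eqxx => ->.
have b'c : b' \notin c by have /setP/(_ b') := ncE; rewrite !inE eqxx orbT => ->.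
have r_id x : x \in c -> r x = x.
  move=> xc; rewrite /r; case: eqVneq => [xE|_]; first by rewrite -xE xc in a'c.
  by case: eqVneq => // xE; rewrite -xE xc in b'c.
pose f x : 'Z_(size c) := ((index (r x) c)%:R)%R.
have f_inj x y : f x = f y -> r x = r y.
  move/eqP; rewrite /f eqr_nat_Zp // !modn_small ?c_n // => /eqP e.
  exact: index_inj.
exists f, a, b, a', b'; split=> //.
- move=> x y; rewrite adj_r adj_sym adj_r adj_sym cE //.
  have nextE u v : (r v == next c (r u)) = (f v == f u + 1)%R.
    rewrite /f natr1 eqr_nat_Zp // -index_next //.
    rewrite modn_small ?c_n //; apply/eqP/eqP => [->//|].
    by apply: index_inj; rewrite ?mem_next.
  by rewrite !nextE.
- move=> z; have z_lt : z < size c by rewrite -{2}(Zp_cast n_gt1).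
  exists (nth a c z); rewrite /f r_id ?mem_nth // index_uniq //.
  by rewrite natr_Zp.
- move=> x y xy /f_inj rxy; rewrite !inE /f (r_id a) // (r_id b) //.
  move: xy rxy (r_id _ ac) (r_id _ bc); rewrite /r.
  case: (eqVneq x a') => [_|xa']; first by rewrite eqxx.
  case: (eqVneq x b') => [_|xb']; first by rewrite eqxx orbT.
  case: (eqVneq y a') => [_ _ ->|ya']; first by rewrite eqxx.
  case: (eqVneq y b') => [_ _ ->|yb']; first by rewrite eqxx orbT.
  by move=> /eqP.
- case/existsP: ab1 => -[[|w []]] //= _ /and3P[].
  by rewrite andbT => aw _ /eqP <-.
Qed.

(** * The first return *)

Theorem theorem2 (k p : nat) (G : sgraph) (k_gt2 : 2 < k) (p_gt1 : 1 < p)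
    (earG : ear_graph G (k ^ p + 1) 1) :
  periodicity_number k G = p.
Proof.
have [n_gt2 [f [a [b [a' [b' [f1 f_surj f_dbl [aa' Na bb' Nb] ab]]]]]]] :=
  ear_coordinate earG.
have k2p : k ^ 2 <= k ^ p by rewrite leq_pexp2l //; lia.
have kn : 2 * k <= k ^ p + 1 by move: k2p; rewrite expnS expn1; nia.
have n_gt4 : 4 < k ^ p + 1 by lia.
have cop : coprime (k ^ p + 1) k.
  rewrite coprime_sym -[p](@ltn_predK 1) // expnS mulnC.
  by rewrite /coprime gcdnMDl gcdn1.
set n := k ^ p + 1 in f f1 f_surj f_dbl n_gt2 kn n_gt4 cop *.
have n_gt1 : 1 < n := ltnW n_gt2.
have opp_kp : ((k ^ p)%:R = -1 :> 'Z_n)%R.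
  apply/eqP; rewrite -addr_eq0 natr1; apply/eqP.
  by apply: etrans (pchar_Zp n_gt1); congr (_%:R)%R; rewrite /n addn1.
have ret_p : returns k G p.+1.
  rewrite /returns ltnS (ltnW p_gt1); apply/asboolP.
  have [i i_bij fi] := kseq_coordinate n_gt1 p k_gt2 kn cop f_surj f1.
  exists i => // x y; rewrite f1 fi opp_kp orbC /=.
  by congr (_ || _); rewrite -subr_eq eq_sym.
(* A return at index [m.+2] means [m.+1] applications, hence step [k ^ m.+1]; assume [m.+1 < p]. *)
have ret_min m : returns k G m -> p < m.
  case/andP=> m_gt1 /asboolP[phi [psi phiK psiK] phi_adj].
  case: m m_gt1 phi psi phiK psiK phi_adj => [|[|m]] // _.
  move=> phi psi phiK psiK phi_adj.
  have [i i_bij fi] := kseq_coordinate n_gt1 m.+1 k_gt2 kn cop f_surj f1.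
  rewrite ltnS leqNgt; apply/negP => m_le.
  have Us : (k ^ m.+1)%:R%R \is a @GRing.unit 'Z_n.
    by rewrite unitZpE // coprimeXr.
  have fi_surj z : exists u, (f \o i) u = z.
    have [u <-] := f_surj z; case: i_bij => j ij ji.
    by exists (j u); rewrite /= ji.
  (* The isomorphism carries twins of [G] to twins of the iterated graph. These share a coordinate,
     so they lie over [f a] or [f b]. *)
  have dbl x y : x != y -> (forall w, adj x w = adj y w) ->
      f (i (psi x)) \in [:: f a; f b].
    move=> xy Nxy; apply: (f_dbl _ (i (psi y))).
      by rewrite (bij_eq i_bij) (can_eq psiK).
    apply: (coordinate_twins n_gt1 fi fi_surj Us n_gt4) => w.
    by rewrite -!phi_adj !psiK.
  have := dbl _ _ aa' Na; have := dbl _ _ bb' Nb.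
  have : adj (psi a) (psi b) by rewrite -phi_adj !psiK.
  (* Since [k <= k ^ m.+1 < k ^ p], the step is none of 0, 1 and -1 in Z/n. *)
  have small j : j \in [:: 0; 1; k ^ p] ->
      ((k ^ m.+1)%:R == j%:R :> 'Z_n)%R = false.
    have lt_kp : k ^ m.+1 < k ^ p by rewrite ltn_exp2l //; lia.
    have k_le : k <= k ^ m.+1 by rewrite expnS leq_pmulr // expn_gt0; lia.
    by rewrite eqr_nat_Zp // !inE => ?; rewrite !modn_small; lia.
  rewrite fi /=; have := ab; rewrite f1.
  move: (small 0) (small 1) (small (k ^ p)); rewrite !inE !eqxx ?orbT opp_kp.
  move=> /(_ isT) s0 /(_ isT) s1 /(_ isT) sN1 fab fxy fb_ab fa_ab.
  (* The adjacent vertices [psi a] and [psi b] both have coordinates among [f a] and [f b], which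
     differ by 1 or -1; the step is a difference of two of these. *)
  suff : ((k ^ m.+1)%:R \in [:: 0; 1; (-1 : 'Z_n)])%R by rewrite !inE s0 s1 sN1.
  move: ((k ^ m.+1)%:R)%R fxy => s fxy {s0 s1 sN1}.
  rewrite !inE in fb_ab fa_ab *.
  have sE (x y : 'Z_n) : (x = y + s -> s = x - y)%R by move=> ->; ring.
  have oneE (x y : 'Z_n) : (x = y + 1 -> x - y = 1 /\ y - x = -1)%R.
    by move=> ->; split; ring.
  case/orP: fxy => /eqP/sE ->; case/orP: fb_ab => /eqP ->;
    case/orP: fa_ab => /eqP ->; rewrite ?subrr ?eqxx //;
    by case/orP: fab => /eqP/oneE[e1 e2]; rewrite ?e1 ?e2 eqxx ?orbT.
rewrite /periodicity_number; case: pselect => [ex|[]]; last by exists p.+1.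
by case: ex_minnP => m /ret_min lt_m /(_ _ ret_p); lia.
Qed.
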